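(* For every integer $n\geq 5$, we have $m(n,n-2)\leq n+3$.
   Context: Graphs are finite and simple; the order of a graph is its number of vertices and its size is its number of edges. An edge $e$ of a connected graph $G$ is a bridge if $G-e$ is disconnected. A graph is bridgeless if it is connected and contains no bridge. An orientation of a graph $G$ is a digraph obtained from $G$ by assigning to each edge $uv$ of $G$ exactly one of the directions $\overrightarrow{uv}$ or $\overrightarrow{vu}$. In a digraph, the distance from $u$ to $v$ is the minimum length (number of arcs) of a directed path from $u$ to $v$, and is $\infty$ if there is no such path. The diameter of a digraph is the maximum, over all ordered pairs $(u,v)$ of vertices, of the distance from $u$ to $v$. For given values $n$ and $d$, $m(n,d)$ denotes the minimum number (integer) $m$ such that every bridgeless graph of order $n$ and size at least $m$ has an orientation of diameter at most $d$ (with $m(n,d)=-\infty$ if every integer $m$ has this property). *)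

(* Defs.v *)
From HB Require Import structures.
From mathcomp Require Import all_boot all_order all_algebra.
From mathcomp Require Import boolp classical_sets constructive_ereal.

Set Implicit Arguments.
Unset Strict Implicit.
Unset Printing Implicit Defensive.

Import Order.TTheory GRing.Theory Num.Theory.

Local Open Scope ring_scope.
Local Open Scope ereal_scope.

Record sgraph := SGraph {
  vertex :> finType;
  adj : rel vertex;
  adj_sym : symmetric adj;
  adj_irr : irreflexive adj }.

(* An edge uv is the two-element set {u, v}. *)
Definition edges (G : sgraph) : {set {set G}} :=
  [set [set p.1; p.2] | p : G * G & adj p.1 p.2].

Definition connected (G : sgraph) : bool :=
  [forall x : G, forall y : G, connect (@adj G) x y].

Section DeleteEdge.
Variables (G : sgraph) (f : {set G}).

Definition del_adj : rel G := [rel x y | adj x y && ([set x; y] != f)].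

Lemma del_adj_sym : symmetric del_adj.
Proof. by move=> x y; rewrite /del_adj /= adj_sym finset.setUC. Qed.

Lemma del_adj_irr : irreflexive del_adj.
Proof. by move=> x; rewrite /del_adj /= adj_irr. Qed.

Definition del_edge : sgraph := SGraph del_adj_sym del_adj_irr.

End DeleteEdge.

Definition bridge (G : sgraph) (f : {set G}) : bool :=
  (f \in edges G) && ~~ connected (del_edge f).

Definition bridgeless (G : sgraph) : bool :=
  connected G && [forall f : {set G}, ~~ bridge f].

Definition orientation (G : sgraph) (D : rel G) : Prop :=
  (forall x y, D x y -> adj x y) /\
  (forall x y, adj x y -> D x y (+) D y x).

Section Digraph.
Variables (T : finType) (D : rel T).

(* There is a directed path with k arcs from u to v; its vertices are u
   followed by the k entries of p. *)
Definition dipath (u v : T) (k : nat) : bool :=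
  [exists p : k.-tuple T, [&& path D u p, uniq (u :: p) & last u p == v]].

Definition distance (u v : T) : \bar int :=
  match pselect (exists k, dipath u v k) with
  | left ex_path => (ex_minn ex_path)%:Z%:E
  | right _ => +oo
  end.

(* The base value -oo only shows when T is empty. *)
Definition diameter : \bar int :=
  \big[maxe/-oo]_(p : T * T) distance p.1 p.2.

End Digraph.

(* Every bridgeless graph of order n and size at least s has an orientation
   of diameter at most d. *)
Definition size_forces (n d : nat) (s : int) : Prop :=
  forall G : sgraph, bridgeless G -> #|G| = n -> (s <= #|edges G|%:Z)%R ->
  exists D : rel G, orientation D /\ diameter D <= d%:Z%:E.

Definition is_min_size (n d : nat) (x : \bar int) : Prop :=
  match x with
  | s%:E => size_forces n d s /\ forall t, size_forces n d t -> (s <= t)%R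
  | -oo => forall s, size_forces n d s
  | +oo => False
  end.

(* m(n, d), with values in the integers and -oo. The default +oo is never
   reached: a value satisfying is_min_size exists (min_sizeP) and is unique
   (is_min_size_uniq). *)
Definition min_size (n d : nat) : \bar int :=
  xget +oo [set x | is_min_size n d x].

Lemma min_sizeP n d : is_min_size n d (min_size n d).
Proof.
suff [x Px] : exists x, is_min_size n d x.
  exact: (@xgetPex _ +oo [set x | is_min_size n d x] (ex_intro _ x Px)).
have [all_s|] := pselect (forall s, size_forces n d s); first by exists -oo.
move=> /existsNP[t Nt].
have mono s s' : size_forces n d s -> (s <= s')%R -> size_forces n d s'.
  by move=> Ps ss' G bG oG sG; apply: Ps => //; exact: le_trans sG.
have big : exists k : nat, `[< size_forces n d (t + k%:Z)%R >].
  exists (`|t| + (2 ^ n).+1)%N; apply/asboolP => G _ oG sG; exfalso.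
  move: sG; apply/negP; rewrite -ltNge.
  have cE : (#|edges G| < (2 ^ n).+1)%N.
    rewrite ltnS (leq_trans (max_card _))//.
    by rewrite -cardsT -powersetT card_powerset cardsT oG.
  rewrite PoszD addrA (lt_le_trans (y := (2 ^ n).+1%:Z)) ?ltz_nat//.
  by rewrite lerDr abszE -lerBlDl sub0r -normrN ler_norm.
have [k /asboolP Pk min_k] := ex_minnP big.
exists (t + k%:Z)%R%:E; split=> // s Ps; rewrite leNgt; apply/negP => sk.
have ts : (t <= s)%R.
  by rewrite leNgt; apply/negP => /ltW st; apply: Nt; exact: mono st.
have sE : s = (t + `|s - t|%N%:Z)%R by rewrite gez0_abs ?subr_ge0// subrKC.
have /min_k : `[< size_forces n d (t + `|s - t|%N%:Z)%R >].
  by apply/asboolP; rewrite -sE.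
by rewrite leqNgt -ltz_nat -(ltrD2l t) -sE sk.
Qed.

Lemma is_min_size_uniq n d x y :
  is_min_size n d x -> is_min_size n d y -> x = y.
Proof.
have no_min s : ~ ((forall t, size_forces n d t) /\
                   forall t, size_forces n d t -> (s <= t)%R).
  by case=> a /(_ (s - 1)%R (a _)); rewrite leNgt ltrBlDr ltrDl ltr01.
case: x => [s| |]; case: y => [t| |] //=.
- by move=> [Ps ms] [Pt mt]; congr (_%:E); apply/le_anti; rewrite ms ?mt.
- by move=> [_ ms] a; case: (no_min s).
- by move=> a [_ mt]; case: (no_min t).
Qed.

(* Main.v *)
(* A strong digraph on n vertices with a pair at distance n - 1 consists of a
   Hamiltonian path v_0, ..., v_(n-1) and of backward arcs, the chords.  We show by
   induction that a strong digraph D with at least n + 3 arcs, that is with at least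
   four chords, can be reoriented to have diameter at most n - 2.
   - A chord whose removal keeps D strong may be deleted if at least n + 3 arcs remain.
   - A vertex of degree 2 with nonadjacent neighbours may be replaced by an arc.
   - A strong set K may be contracted if no edges get merged: a path in the quotient
     passes the contracted vertex at most once, which costs at most |K| - 1 more steps.
   With five chords or more, none of which is redundant, some contraction is possible.
   With exactly four chords, each inner vertex of the path is an end of a chord or the
   middle vertex of a chord of length 2 (else it has degree 2 and nonadjacent
   neighbours), so n <= 12, and the remaining graphs are checked by computation. *)

Require Import Defs.
From mathcomp Require Import all_boot all_order all_algebra.
From mathcomp Require Import boolp classical_sets constructive_ereal.
From mathcomp Require Import zify.

Import Order.TTheory GRing.Theory Num.Theory.

Local Open Scope ring_scope.
Local Open Scope ereal_scope.

Set Implicit Arguments.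
Unset Strict Implicit.
Unset Printing Implicit Defensive.

(** * Strong digraphs and Robbins' theorem *)

Section Digraphs.
Local Open Scope nat_scope.

Definition oriented (T : finType) (D : rel T) := forall x y, D x y -> ~~ D y x.
Definition strong (T : finType) (D : rel T) := forall x y, connect D x y.
Definition undirected (T : finType) (D : rel T) : rel T :=
  [rel x y | D x y || D y x].
Definition arcs (T : finType) (D : rel T) : {set T * T} :=
  [set p | D p.1 p.2].

(** Repeated vertices and shorter lengths are allowed, so bounds add up under concatenation. *)
Definition reach (T : finType) (D : rel T) k x y :=
  exists p, [/\ path D x p, last x p = y & size p <= k].

Definition reorientable (T : finType) (D : rel T) :=
  exists E : rel T,
    [/\ oriented E, undirected E =2 undirected D &
        forall x y, reach E (#|T| - 2) x y].

Section Reach.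
Variables (T : finType) (D : rel T).

Lemma reach0 x : reach D 0 x x.
Proof. by exists [::]. Qed.

Lemma reach1 x y : D x y -> reach D 1 x y.
Proof. by move=> Dxy; exists [:: y]; rewrite /= Dxy. Qed.

Lemma reachD k l x y z : reach D k x y -> reach D l y z -> reach D (k + l) x z.
Proof.
move=> [p [Dp <- sp]] [q [Dq <- sq]]; exists (p ++ q).
by rewrite cat_path Dp last_cat size_cat leq_add.
Qed.

Lemma leq_reach k l x y : k <= l -> reach D k x y -> reach D l x y.
Proof. by move=> kl [p [Dp lp sp]]; exists p; split=> //; apply: leq_trans kl. Qed.

Lemma reach_uniq k x y : reach D k x y ->
  exists p, [/\ path D x p, last x p = y, size p <= k & uniq (x :: p)].
Proof.
move=> [p [Dp <- sp]]; case/shortenP: Dp => q Dq Uq qp.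
exists q; split=> //; apply: leq_trans sp; apply: uniq_leq_size => //.
by case/andP: Uq.
Qed.

Lemma connect_exit (A : pred T) x y :
  connect D x y -> A x -> ~~ A y -> exists a b, [/\ A a, ~~ A b & D a b].
Proof.
move=> /connectP[p Dp ->]; elim: p x Dp => [x _ Ax|z p IH x /= /andP[Dxz Dp] Ax].
  by rewrite /= Ax.
by case Az: (A z); [exact: IH | exists x, z; rewrite Az].
Qed.

End Reach.

Lemma oriented_irr (T : finType) (D : rel T) x : oriented D -> D x x = false.
Proof. by move=> oD; apply/negbTE/negP => Dxx; have:= oD _ _ Dxx; rewrite Dxx. Qed.

Lemma undirectedE (T : finType) (D : rel T) x y :
  undirected D x y = D x y || D y x.
Proof. by []. Qed.

Lemma undirected_sym (T : finType) (D : rel T) : symmetric (undirected D).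
Proof. by move=> x y; rewrite !undirectedE orbC. Qed.

(** Edges absent from [D'] keep their direction in [D]; extra arcs never destroy a walk. *)
Lemma reorientableS (T : finType) (D D' : rel T) :
  oriented D -> subrel D' D -> reorientable D' -> reorientable D.
Proof.
move=> oD sD [E [oE uE rE]].
exists [rel x y | E x y || (D x y && ~~ undirected D' x y)]; split.
- move=> x y; have := uE x y; move/implyP: (oE x y); move/implyP: (oD x y).
  rewrite ?undirectedE /= ?undirectedE.
  by case: (E x y); case: (E y x); case: (D x y); case: (D y x);
    case: (D' x y); case: (D' y x).
- move=> x y; have := uE x y; move/implyP: (sD x y); move/implyP: (sD y x).
  rewrite ?undirectedE /= ?undirectedE.
  by case: (E x y); case: (E y x); case: (D x y); case: (D y x);
    case: (D' x y); case: (D' y x).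
- move=> x y; have [p [Dp lp sp]] := rE x y; exists p; split=> //.
  by apply: sub_path Dp => a b /= ->.
Qed.

(* Boesch and Tindell: start from all edges being two-way and make them one-way one
   at a time.  If neither direction of uv can be dropped, then the sets reached
   from u and from v without using uv partition the graph, so uv is a bridge. *)
Lemma one_way (G : sgraph) (R : rel G) u v :
    bridgeless G -> (forall x y, R x y || R y x = adj x y) -> strong R ->
    R u v -> R v u ->
  exists2 R' : rel G, (forall x y, R' x y || R' y x = adj x y) /\ strong R' &
    #|[set p | R' p.1 p.2]| < #|[set p | R p.1 p.2]|.
Proof.
move=> bG uR sR Ruv Rvu.
pose R0 := [rel x y | R x y && ((x, y) != (u, v)) && ((x, y) != (v, u))].
(* In any walk, the arc ab can be replaced by a walk of [R0] from a to b. *)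
have drop a b : R a b -> R b a -> (forall x y, R0 x y -> R x y && ((x, y) != (a, b))) ->
    connect R0 a b ->
  exists2 R' : rel G, (forall x y, R' x y || R' y x = adj x y) /\ strong R' &
    #|[set p | R' p.1 p.2]| < #|[set p | R p.1 p.2]|.
  move=> Rab Rba s0 cab.
  have nab : a != b.
    by apply: contraTneq Rab => ->; have := uR b b; rewrite adj_irr orbb => ->.
  exists [rel x y | R x y && ((x, y) != (a, b))]; first split.
  - move=> x y; rewrite -uR /= !xpair_eqE.
    have nba : (b == a) = false by rewrite eq_sym (negbTE nab).
    case: (x =P a) => [->|_]; case: (y =P b) => [->|_] /=.
    + by rewrite nba Rab Rba.
    + by rewrite (negbTE nab) andbF !andbT.
    + by rewrite nba !andbT.
    + case: (y =P a) => [->|_] /=; last by rewrite !andbT.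
      by case: (x =P b) => [->|_] /=; rewrite ?Rba // !andbT.
  - move=> x y; have := sR x y; apply: connect_sub => {}x {}y Rxy.
    have [[-> ->]|ne] := (x, y) =P (a, b).
      by apply: connect_sub cab => c d /s0 Rcd; apply: connect1.
    by apply: connect1; rewrite /= Rxy; apply/eqP.
  - apply: proper_card; apply/properP; split.
      by apply/fintype.subsetP => p; rewrite !inE => /andP[].
    by exists (a, b); rewrite !inE //= eqxx andbF.
have [cuv|ncuv] := boolP (connect R0 u v).
  by apply: (drop u v) => // x y /= /andP[].
have [cvu|ncvu] := boolP (connect R0 v u).
  by apply: (drop v u) => // x y /= /andP[/andP[-> _]].
have R0P x y : R x y -> [\/ R0 x y, x = u /\ y = v | x = v /\ y = u].
  move=> Rxy; have [[-> ->]|/eqP n1] := (x, y) =P (u, v); first exact: Or32.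
  have [[-> ->]|/eqP n2] := (x, y) =P (v, u); first exact: Or33.
  by apply: Or31; rewrite /= Rxy n1.
(* A walk of [R] could leave this set only by uv or vu, whose heads lie in it. *)
have from x : connect R0 u x || connect R0 v x.
  apply/negPn/negP => nx.
  pose A x := connect R0 u x || connect R0 v x.
  have [|a [b [Aa Ab Rab]]] := connect_exit (A := A) (sR u x) _ nx.
    by rewrite /A connect0.
  rewrite /A in Aa Ab; case: (R0P _ _ Rab) => [R0ab|[_ eb]|[_ eb]]; first 2 last.
  - by rewrite eb connect0 in Ab.
  - move/negP: Ab; apply; have c1 : connect R0 a b by apply: connect1.
    by case/orP: Aa => c; rewrite (connect_trans c c1) ?orbT.
  - by rewrite eb connect0 orbT in Ab.
have to x : connect R0 x u || connect R0 x v.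
  apply/negPn/negP => nx.
  pose A x := ~~ (connect R0 x u || connect R0 x v).
  have [||a [b [Aa Ab Rab]]] := connect_exit (A := A) (sR x u).
  - exact: nx.
  - by rewrite /A connect0.
  rewrite /A in Aa Ab; move/negPn: Ab => Ab.
  case: (R0P _ _ Rab) => [R0ab|[ea _]|[ea _]]; first 2 last.
  - by rewrite ea connect0 orbT in Aa.
  - move/negP: Aa; apply; have c1 : connect R0 a b by apply: connect1.
    by case/orP: Ab => c; rewrite (connect_trans c1 c) ?orbT.
  - by rewrite ea connect0 in Aa.
have vuD x : connect R0 v x -> connect R0 x u = false.
  by move=> c; apply: contraNF ncvu; apply: connect_trans c.
have uvD x : connect R0 u x -> connect R0 x v = false.
  by move=> c; apply: contraNF ncuv; apply: connect_trans c.
have vu x : connect R0 v x = ~~ connect R0 u x.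
  have := from x; have := to x.
  case cu: (connect R0 u x); case cv: (connect R0 v x) => //.
  by rewrite (vuD _ cv) (uvD _ cu).
(* As uv is no bridge, another edge leaves the set reached from u; either direction of it in [R0]
   contradicts the partition. *)
exfalso; case/andP: bG => _ /forallP /(_ [set u; v]%SET); rewrite /bridge negb_and !negbK.
case/orP => [/imsetP[]|/forallP /(_ u) /forallP /(_ v) cuv].
  by exists (u, v) => //; rewrite inE /= -uR Ruv.
have [|a [b [Aa Ab /andP[]]]] := connect_exit (A := connect R0 u) cuv _ ncuv.
  exact: connect0.
rewrite -uR => Rab nab.
have {}nab : (a, b) != (u, v) /\ (a, b) != (v, u).
  by split; apply: contraNneq nab => -[-> ->] //; rewrite finset.setUC.
case/orP: Rab => Rab; case: (R0P _ _ Rab) => [R0ab|[e1 e2]|[e1 e2]].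
- have c1 : connect R0 a b by apply: connect1.
  by rewrite (connect_trans Aa c1) in Ab.
- by rewrite e1 e2 eqxx in nab; case: nab.
- by rewrite e1 e2 eqxx in nab; case: nab.
- have c1 : connect R0 b a by apply: connect1.
  by rewrite -vu in Ab; have := connect_trans Ab c1; rewrite vu Aa.
- by rewrite e1 e2 eqxx in nab; case: nab.
- by rewrite e1 e2 eqxx in nab; case: nab.
Qed.

Lemma robbins (G : sgraph) : bridgeless G ->
  exists D : rel G, [/\ oriented D, undirected D =2 @adj G & strong D].
Proof.
move=> bG; have [cG _] := andP bG.
suff H k : forall R : rel G, #|[set p | R p.1 p.2]| < k -> undirected R =2 @adj G ->
    strong R -> exists D : rel G, [/\ oriented D, undirected D =2 @adj G & strong D].
  apply: (H _ (@adj G) (ltnSn _)).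
    by move=> x y; rewrite !undirectedE (adj_sym y) orbb.
  by move=> x y; move/forallP: cG => /(_ x) /forallP /(_ y).
elim: k => // k IH R; rewrite ltnS => cR uR sR.
have [oR|] := boolP [forall x, forall y, R x y ==> ~~ R y x].
  exists R; split=> // x y Rxy.
  by move: oR => /forallP /(_ x) /forallP /(_ y) /implyP; apply.
rewrite negb_forall => /existsP[x]; rewrite negb_forall => /existsP[y].
rewrite negb_imply negbK => /andP[Rxy Ryx].
have [R' [uR' sR'] cR'] := one_way bG uR sR Rxy Ryx.
by apply: (IH R') => //; apply: leq_trans cR' cR.
Qed.

End Digraphs.

(** * Suppressing a vertex of degree 2 *)

Section Suppress.
Local Open Scope nat_scope.
Variables (T : finType) (D : rel T) (w a b : T).
Hypotheses (oD : oriented D) (sD : strong D) (Daw : D a w) (Dwb : D w b).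
Hypotheses (in_w : forall x, D x w -> x = a) (out_w : forall x, D w x -> x = b).
Hypothesis nab : ~~ undirected D a b.

Let aw : a != w.
Proof. by apply: contraTneq Daw => ->; rewrite oriented_irr. Qed.

Let bw : b != w.
Proof. by apply: contraTneq Dwb => ->; rewrite oriented_irr. Qed.

Let ab : a != b.
Proof. by apply: contraTneq Dwb => <-; exact: oD. Qed.

Definition suppress_type := {x : T | x != w}.
Let a' : suppress_type := Sub a aw.
Let b' : suppress_type := Sub b bw.

Definition suppress : rel suppress_type :=
  [rel x y | D (val x) (val y) || (val x == a) && (val y == b)].

Lemma suppressE x y :
  suppress x y = D (val x) (val y) || (val x == a) && (val y == b).
Proof. by []. Qed.

Lemma card_suppress : #|{: suppress_type}|.+1 = #|T|.
Proof.
rewrite card_sig (eq_card (B := predC1 w)) => [|x]; last by rewrite !inE.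
by rewrite cardC1 prednK //; apply/card_gt0P; exists w.
Qed.

(** As a and b are nonadjacent, the new arc has no opposite. *)
Lemma suppress_oriented : oriented suppress.
Proof.
move=> x y /= /orP[Dxy|/andP[/eqP xa /eqP yb]]; rewrite negb_or.
  rewrite oD //=; apply: contraNN nab => /andP[/eqP ya /eqP xb].
  by rewrite !undirectedE -ya -xb Dxy orbT.
rewrite xa yb eq_sym (negbTE ab) andbF andbT.
by apply: contraNN nab => Dba; rewrite !undirectedE Dba orbT.
Qed.

Lemma suppress_strong : strong suppress.
Proof.
move=> x y; apply/connectP.
have [p Dp ly] := connectP (sD (val x) (val y)).
(* A walk of [D] is followed arc by arc; while it is at w, its image waits at a. *)
have : exists q, path suppress x q /\
    val (last x q) = if last (val x) p == w then a else last (val x) p.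
  elim/last_ind: p Dp {ly} => [_|p z IH].
    by exists [::]; rewrite /= (negbTE (valP x)).
  rewrite rcons_path last_rcons => /andP[/IH [q [Dq lq]] Dz].
  have [zw|zw] := eqVneq z w.
    exists q; split=> //; rewrite lq; rewrite zw in Dz.
    by rewrite (in_w Dz) (negbTE aw).
  exists (rcons q (Sub z zw)); rewrite rcons_path last_rcons Dq; split=> //.
  rewrite suppressE lq SubK; case: eqP Dz => [->|_] Dz; last by rewrite Dz.
  by rewrite eqxx (out_w Dz) eqxx orbT.
rewrite -ly (negbTE (valP y)) => -[q [Dq lq]]; exists q => //.
exact/esym/val_inj.
Qed.

(** The new arc stands for aw and every other arc for itself, which misses only wb. *)
Lemma card_arcs_suppress : #|arcs D| <= #|arcs suppress|.+1.
Proof.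
pose f (p : suppress_type * suppress_type) :=
  if p == (a', b') then (a, w) else (val p.1, val p.2).
apply: (@leq_trans #|(w, b) |: f @: arcs suppress|); last first.
  apply: (leq_trans (leq_card_setU _ _)); rewrite cards1 add1n ltnS.
  exact: leq_imset_card.
apply/subset_leq_card/fintype.subsetP => -[x y]; rewrite !inE /= => Dxy.
have [xw|xw] := eqVneq x w.
  by rewrite xw in Dxy *; rewrite (out_w Dxy) eqxx.
apply/orP; right; have [yw|yw] := eqVneq y w.
  rewrite yw in Dxy *; rewrite (in_w Dxy).
  by apply/imsetP; exists (a', b'); rewrite /f ?eqxx // inE /suppress /= !eqxx orbT.
apply/imsetP; exists (Sub x xw, Sub y yw); first by rewrite inE /suppress /= Dxy.
rewrite /f; case: eqP => [[xa yb]|] //.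
by rewrite xa yb in Dxy; move: nab; rewrite !undirectedE Dxy.
Qed.

Section Lift.
Variable E : rel suppress_type.
Hypotheses (oE : oriented E) (uE : undirected E =2 undirected suppress).

Let i x : suppress_type := insubd a' x.
Let fwd := E a' b'.

Let iK (x : suppress_type) : i (val x) = x.
Proof. exact: valKd. Qed.

(** The edge ab of the smaller graph becomes the path a, w, b, traversed in the direction that [E]
    gives to ab. *)
Let F : rel T := [rel x y | undirected D x y &&
  (if x == w then (y == b) == fwd else if y == w then (x == a) == fwd
   else E (i x) (i y))].

Let Eab : E b' a' = ~~ fwd.
Proof.
have := uE a' b'; rewrite !undirectedE !suppressE !SubK !eqxx orbT /= -/fwd.
by have := @oE a' b'; rewrite -/fwd; case: fwd => [/(_ isT)/negbTE|] //=.
Qed.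

Let und_w y : undirected D w y -> y = a \/ y = b.
Proof. by case/orP => [/out_w|/in_w] ->; [right|left]. Qed.

Let oF : oriented F.
Proof.
move=> x y /= /andP[uxy Fxy]; rewrite negb_and; apply/orP; right.
have xy : x != y.
  by apply: contraTneq uxy => ->; rewrite !undirectedE orbb oriented_irr.
move: Fxy; case: (eqVneq x w) => [xw|xw]; case: (eqVneq y w) => [yw|yw].
- by rewrite xw yw eqxx in xy.
- move/eqP <-; case: (@und_w y); rewrite -?xw // => ->; rewrite ?eqxx.
    by rewrite (negbTE ab).
  by rewrite [b == a]eq_sym (negbTE ab).
- move/eqP <-; case: (@und_w x); rewrite -?yw ?[undirected D y x]undirected_sym // => ->;
    rewrite ?eqxx.
    by rewrite (negbTE ab).
  by rewrite [b == a]eq_sym (negbTE ab).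
- exact: oE.
Qed.

Let uF : undirected F =2 undirected D.
Proof.
move=> x y; rewrite {1}undirectedE /F /= (undirected_sym D y) -andb_orr.
case uxy: (undirected D x y) => //=.
have xy : x != y.
  by apply: contraTneq uxy => ->; rewrite !undirectedE orbb oriented_irr.
case: (eqVneq x w) => [xw|xw]; case: (eqVneq y w) => [yw|yw].
- by rewrite xw yw eqxx in xy.
- case: (@und_w y); rewrite -?xw // => ->; rewrite ?eqxx.
    by rewrite (negbTE ab); case: fwd.
  by rewrite [b == a]eq_sym (negbTE ab); case: fwd.
- case: (@und_w x); rewrite -?yw ?[undirected D y x]undirected_sym // => ->;
    rewrite ?eqxx.
    by rewrite (negbTE ab); case: fwd.
  by rewrite [b == a]eq_sym (negbTE ab); case: fwd.
- have := uE (i x) (i y); rewrite !undirectedE !suppressE !insubdK // => ->.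
  by move: uxy; rewrite !undirectedE => /orP[] ->; rewrite ?orbT.
Qed.

Let s : suppress_type := if fwd then a' else b'.
Let t : suppress_type := if fwd then b' else a'.

Let Fsw : F (val s) w.
Proof.
rewrite /F /= eqxx (negbTE (valP s)) /s; case: fwd => /=.
  by rewrite !undirectedE Daw eqxx.
by rewrite !undirectedE Dwb orbT [b == a]eq_sym (negbTE ab).
Qed.

Let Fwt : F w (val t).
Proof.
rewrite /F /= eqxx /t; case: fwd => /=.
  by rewrite !undirectedE Dwb eqxx.
by rewrite !undirectedE Daw orbT (negbTE ab).
Qed.

Let Earc x y : E x y -> F (val x) (val y) \/ x = s /\ y = t.
Proof.
move=> Exy; case uxy: (undirected D (val x) (val y)).
  by left; rewrite /F /= uxy (negbTE (valP x)) (negbTE (valP y)) !iK Exy.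
right; have := uE x y; rewrite {1}undirectedE Exy /= undirectedE !suppressE.
move: uxy; rewrite !undirectedE => /negbT.
rewrite negb_or => /andP[/negbTE -> /negbTE ->] /=.
move/esym/orP => [/andP[/eqP xa /eqP yb]|/andP[/eqP ya /eqP xb]].
  have [ex ey] : x = a' /\ y = b' by split; apply: val_inj.
  by rewrite /s /t; rewrite ex ey in Exy; rewrite /fwd Exy.
have [ex ey] : x = b' /\ y = a' by split; apply: val_inj.
by rewrite /s /t; rewrite ex ey Eab in Exy; rewrite (negbTE Exy).
Qed.

(* The path meets the arc between s and t at most once, and only there it gets longer. *)
Let lift x p : path E x p -> uniq (x :: p) ->
  reach F (size p + (t \in p) && (last x p != s)) (val x) (val (last x p)).
Proof.
elim: p x => [x _ _|y p IH x /= /andP[/Earc Exy Ep] /andP[xyp Uyp]].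
  exact: reach0.
have {}IH := IH y Ep Uyp.
case: Exy => [Fxy|[xs yt]].
  apply: leq_reach (reachD (reach1 Fxy) IH).
  rewrite add1n addSn ltnS leq_add2l in_cons.
  by case: (t == y) => //=; case: (t \in p); case: (_ != s).
rewrite xs yt in xyp Uyp IH *.
have tp : t \notin p by case/andP: Uyp.
rewrite (negbTE tp) /= addn0 in IH.
apply: leq_reach (reachD (reach1 Fsw) (reachD (reach1 Fwt) IH)).
rewrite in_cons eqxx /=.
have -> : last t p != s by apply: contraNneq xyp => <-; exact: mem_last.
by rewrite !add1n /= addn1.
Qed.

(** A simple path that starts at [t] or ends at [s] cannot use the arc from [s] to [t], so it lifts
    without loss. This saves the step needed to leave w through [t] or to enter w from [s]. *)
Let reach_lift k x y : reach E k x y ->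
  reach F (k + ((x != t) && (y != s))) (val x) (val y).
Proof.
case/reach_uniq => p [Ep <- sp Up]; apply: leq_reach (lift Ep Up).
rewrite leq_add //; have [xt|_] := eqVneq x t; last by case: (t \in p).
by rewrite xt in Up; case/andP: Up => /negbTE ->.
Qed.

Lemma suppress_lift k : (forall x y, reach E k x y) ->
  exists F : rel T, [/\ oriented F, undirected F =2 undirected D &
    forall x y, reach F k.+1 x y].
Proof.
move=> rE; exists F; split=> // x y.
have [->|xw] := eqVneq x w; have [->|yw] := eqVneq y w.
- by apply: leq_reach (reach0 _ _).
- have := reach_lift (rE t (Sub y yw)); rewrite eqxx addn0 => r.
  by rewrite -add1n; apply: reachD r; apply: reach1.
- have := reach_lift (rE (Sub x xw) s); rewrite eqxx andbF addn0 => r.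
  by rewrite -addn1; apply: reachD r _; apply: reach1.
- apply: leq_reach (reach_lift (rE (Sub x xw) (Sub y yw))).
  by rewrite -addn1 leq_add2l; case: (_ && _).
Qed.
End Lift.
End Suppress.

(** * Contracting a strong set *)

Section Contract.
Local Open Scope nat_scope.
Variables (T : finType) (D : rel T) (K : {set T}) (k0 : T).

Definition induced : rel T := [rel x y | [&& D x y, x \in K & y \in K]].

Hypotheses (oD : oriented D) (sD : strong D) (k0K : k0 \in K).
Hypothesis sK : {in K &, forall x y, connect induced x y}.
Hypothesis one_nbr : forall z y y', z \notin K -> y \in K -> y' \in K ->
  undirected D z y -> undirected D z y' -> y = y'.

Definition contract_type := {x : T | (x == k0) || (x \notin K)}.
Let c0 : contract_type := Sub k0 (predU1l _ (erefl k0)).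
Definition collapse x : contract_type := insubd c0 (if x \in K then k0 else x).

Lemma val_collapse x : val (collapse x) = if x \in K then k0 else x.
Proof. by rewrite val_insubd; case xK: (x \in K); rewrite ?eqxx ?xK ?orbT. Qed.

Lemma collapseK (x : contract_type) : collapse (val x) = x.
Proof.
apply: val_inj; rewrite val_collapse.
by case: ifP => // xK; have := valP x; rewrite xK orbF => /eqP.
Qed.

Lemma collapse_in x : x \in K -> collapse x = c0.
Proof. by move=> xK; apply: val_inj; rewrite val_collapse xK. Qed.

Lemma collapse_out x y : x \notin K -> collapse x = collapse y -> x = y.
Proof.
move=> xK /(congr1 val); rewrite !val_collapse (negbTE xK).
by case: ifP => // _ xk; rewrite xk k0K in xK.
Qed.

Definition contraction : rel contract_type :=
  [rel p q | (p != q) &&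
     [exists x, exists y, [&& collapse x == p, collapse y == q & D x y]]].

Lemma contractP p q : reflect
  (p != q /\ exists x y, [/\ collapse x = p, collapse y = q & D x y])
  (contraction p q).
Proof.
apply: (iffP andP) => -[pq H]; split=> //.
  by case/existsP: H => x /existsP[y /and3P[/eqP xp /eqP yq Dxy]]; exists x, y.
case: H => x [y [xp yq Dxy]]; apply/existsP; exists x; apply/existsP; exists y.
by rewrite xp yq !eqxx.
Qed.

Lemma card_contract : #|{: contract_type}| + #|K| = #|T|.+1.
Proof.
have e : (fun x : T => (x == k0) || (x \notin K)) =i k0 |: ~: K.
  by move=> x; rewrite !inE.
by rewrite card_sig (eq_card e) cardsU1 !inE k0K /= add1n addSn addnC cardsC.
Qed.

(** An edge with distinct images has at most one end in [K], and [one_nbr] determines that end from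
    the other one. Hence different edges never get merged. *)
Lemma collapse_inj x y x' y' : undirected D x y -> undirected D x' y' ->
  collapse x != collapse y -> collapse x = collapse x' ->
  collapse y = collapse y' -> x = x' /\ y = y'.
Proof.
move=> Dxy Dxy' ne xx yy.
have [xK|xK] := boolP (x \in K); last first.
  have ex := collapse_out xK xx; split=> //; subst x'.
  have [yK|yK] := boolP (y \in K); last exact: collapse_out yy.
  apply: (one_nbr xK) => //.
  by apply: contraTT yK => y'K; rewrite -(collapse_out y'K (esym yy)).
have yK : y \notin K by apply: contraNN ne => yK; rewrite !collapse_in.
have ey := collapse_out yK yy; split=> //; subst y'.
apply: (one_nbr yK) => //; rewrite 1?undirected_sym //.
by apply: contraTT xK => x'K; rewrite -(collapse_out x'K (esym xx)).
Qed.

Lemma contract_oriented : oriented contraction.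
Proof.
move=> p q /contractP[pq [x [y [xp yq Dxy]]]]; apply/negP.
move=> /contractP[_ [y' [x' [y'q x'p Dyx']]]].
have [|||||ex ey] := @collapse_inj x y x' y';
  rewrite ?undirectedE ?Dxy ?Dyx' ?orbT ?xp ?yq //.
by subst; have := oD Dxy; rewrite Dyx'.
Qed.

Lemma contract_strong : strong contraction.
Proof.
move=> p q; rewrite -(collapseK p) -(collapseK q).
have /connectP[s Ds ->] := sD (val p) (val q).
elim: s (val p) Ds => [x _|y s IH x /= /andP[Dxy /IH]]; first exact: connect0.
apply: connect_trans; have [->|ne] := eqVneq (collapse x) (collapse y).
  exact: connect0.
by apply: connect1; apply/contractP; split=> //; exists x, y.
Qed.

Lemma card_arcs_contract : #|arcs D| <= #|arcs contraction| + #|arcs induced|.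
Proof.
rewrite addnC.
pose f (p : T * T) := (collapse p.1, collapse p.2).
have fi : {in [set p in arcs D | collapse p.1 != collapse p.2]%SET &, injective f}.
  move=> [x y] [x' y']; rewrite !inE /= => /andP[Dxy ne] /andP[Dxy' _] [xx yy].
  have uxy : undirected D x y by rewrite undirectedE Dxy.
  have uxy' : undirected D x' y' by rewrite undirectedE Dxy'.
  by have [-> ->] := collapse_inj uxy uxy' ne xx yy.
rewrite -(cardsID (arcs induced) (arcs D)) leq_add //.
  exact/subset_leq_card/subsetIr.
apply: (@leq_trans #|f @: [set p in arcs D | collapse p.1 != collapse p.2]%SET|).
  rewrite card_in_imset //; apply/subset_leq_card/fintype.subsetP => -[x y].
  rewrite !inE /= => /andP[nK Dxy]; rewrite Dxy /=.
  apply: contraNN nK => /eqP xy; rewrite /induced /= Dxy.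
  have xK : x \in K.
    apply: contraTT Dxy => xK; rewrite (collapse_out xK xy).
    by rewrite oriented_irr.
  rewrite xK; apply: contraTT Dxy => yK.
  by rewrite (collapse_out yK (esym xy)) oriented_irr.
apply/subset_leq_card/fintype.subsetP => _ /imsetP[[x y] /= + ->].
rewrite !inE /= => /andP[Dxy ne]; apply/contractP.
by split=> //; exists x, y.
Qed.

Section Lift.
Variable E : rel contract_type.
Hypotheses (oE : oriented E) (uE : undirected E =2 undirected contraction).

(** Inside [K] the directions of [D] are kept, so [K] stays strong. *)
Let F : rel T := [rel x y | if (x \in K) && (y \in K) then D x y
  else undirected D x y && E (collapse x) (collapse y)].

Let oF : oriented F.
Proof.
move=> x y; rewrite /F /= [(y \in K) && _]andbC.
case: ifP => _; first exact: oD.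
by rewrite (undirected_sym D y) => /andP[-> /oE].
Qed.

Let uF : undirected F =2 undirected D.
Proof.
move=> x y; rewrite undirectedE /F /= [(y \in K) && _]andbC.
case: ifP => // xyK; rewrite (undirected_sym D y) -andb_orr.
case uxy: (undirected D x y) => //=.
have ne : collapse x != collapse y.
  apply: contraTneq uxy => xy; rewrite undirectedE.
  have -> : x = y.
    case/negbT/nandP: xyK => nK; first exact: collapse_out xy.
    exact/esym/(collapse_out nK).
  by rewrite orbb oriented_irr.
have := uE (collapse x) (collapse y); rewrite !undirectedE => ->.
case/orP: uxy => Dxy; apply/orP; [left|right]; apply/contractP.
  by split=> //; exists x, y.
by split; [rewrite eq_sym|exists y, x].
Qed.

Let reach_in x y : x \in K -> y \in K -> reach F #|K|.-1 x y.
Proof.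
move=> xK yK; have /connectP[p Dp ly] := sK xK yK.
case/shortenP: Dp ly => {}p Dp Up _ ly.
have pK : {subset x :: p <= K}.
  move=> z; rewrite inE => /orP[/eqP -> //|].
  elim: p x {xK Up ly} Dp => // u p IH x /= /andP[/and3P[_ _ uK] /IH{}IH].
  by rewrite inE => /orP[/eqP -> //|].
exists p; split=> //.
  by apply: sub_path Dp => u v /and3P[Duv uK vK]; rewrite /F /= uK vK.
have : size (x :: p) <= #|K|.
  by rewrite -(card_uniqP Up) subset_leq_card //; apply/fintype.subsetP.
by case: #|K|.
Qed.

Let Earc p q : E p q -> exists x y, [/\ collapse x = p, collapse y = q & F x y].
Proof.
move=> Epq.
have : undirected contraction p q by rewrite -uE undirectedE Epq.
suff main x y : undirected D x y -> p != q -> collapse x = p -> collapse y = q ->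
    exists x y, [/\ collapse x = p, collapse y = q & F x y].
  case/orP => /contractP[pq [x [y [xp yq Dxy]]]].
    by apply: main xp yq => //; rewrite undirectedE Dxy.
  by apply: main yq xp; rewrite 1?eq_sym // undirectedE Dxy orbT.
move=> uxy pq xp yq; exists x, y; split=> //; rewrite /F /= uxy xp yq Epq.
case: ifP => // /andP[xK yK]; move: pq.
by rewrite -xp -yq !collapse_in // eqxx.
Qed.

Let lift p x y : path E (collapse x) p -> uniq (collapse x :: p) ->
  last (collapse x) p = collapse y ->
  reach F (size p + (if c0 \in collapse x :: p then #|K|.-1 else 0)) x y.
Proof.
elim: p x => [x _ _ /= xy|q p IH x].
  have [xK|xK] := boolP (x \in K); last first.
    by rewrite (collapse_out xK xy); apply: leq_reach (reach0 _ _).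
  rewrite collapse_in // inE eqxx add0n; apply: reach_in => //.
  by apply: contraTT xK => yK; rewrite -(collapse_out yK (esym xy)).
rewrite [path _ _ _]/= cons_uniq => /andP[/Earc[a [b [ax bq Fab]]] Ep] /andP[xp Up] /= ly.
subst q; have {}IH := IH b Ep Up ly.
have Fb := reachD (reach1 Fab) IH.
have [xK|xK] := boolP (x \in K); last first.
  rewrite (collapse_out xK (esym ax)) in_cons.
  have /negbTE -> : c0 != collapse a.
    rewrite ax; apply/eqP => /(congr1 val); rewrite val_collapse (negbTE xK) /= => xk.
    by rewrite -xk k0K in xK.
  exact: leq_reach Fb.
have aK : a \in K by apply: contraTT xK => aK; rewrite -(collapse_out aK ax).
(* Here x lies in [K] and the rest of the path avoids [c0]: walk inside [K] from x to the tail a of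
   the lifted arc. *)
rewrite (collapse_in xK) in xp *; rewrite (negbTE xp) addn0 in Fb.
rewrite mem_head addnC; exact: reachD (reach_in xK aK) Fb.
Qed.

Lemma contract_lift k : (forall x y, reach E k x y) ->
  exists F : rel T, [/\ oriented F, undirected F =2 undirected D &
    forall x y, reach F (k + #|K|.-1) x y].
Proof.
move=> rE; exists F; split=> // x y.
have [p [Ep ly sp Up]] := reach_uniq (rE (collapse x) (collapse y)).
apply: leq_reach (lift Ep Up ly).
by apply: leq_add => //; case: ifP.
Qed.

End Lift.
End Contract.

(** * Four chords on at most twelve vertices *)

Section FiniteCheck.
Local Open Scope nat_scope.

Definition chord_pairs n : seq (nat * nat) :=
  [seq (i, j) | i <- iota 0 n, j <- iota i.+2 (n - i.+2)].

Definition path_pairs i k : seq (nat * nat) := [seq (j, j.+1) | j <- iota i k].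

(** One round of breadth-first search: the test reads the old set [S], so a round follows one arc
    only. *)
Definition spread (A : seq (nat * nat)) (S : bitseq) : bitseq :=
  foldl (fun S' a => if nth false S a.1 then set_nth false S' a.2 true else S') S A.

Definition diam_le n k (A : seq (nat * nat)) : bool :=
  all (fun u => let S := iter k (spread A) (set_nth false (nseq n false) u true) in
                all (nth false S) (iota 0 n)) (iota 0 n).

Fixpoint sublists (cs : seq (nat * nat)) : seq (seq (nat * nat)) :=
  if cs is c :: cs' then let L := sublists cs' in [seq c :: l | l <- L] ++ L
  else [:: [::]].

(* Reversing one interval of the path and a set of chords turns out to be enough. *)
Definition flips n cs : seq (seq (nat * nat)) :=
  let intervals := [seq path_pairs c.1 (c.2 - c.1) |
    c <- path_pairs 0 n.-1 ++ chord_pairs n] in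
  [seq R ++ B | R <- [::] :: intervals, B <- sublists cs].

(** Pairs in [F] point from the larger index to the smaller one, all others upward. So the original
    digraph, whose chords go backward, is the case where [F] consists of all chords. *)
Definition flip (F : seq (nat * nat)) (c : nat * nat) :=
  if c \in F then (c.2, c.1) else c.

(* [find] rather than [has]: under call-by-value evaluation the disjunction in [has]
   would go through the whole list. *)
Definition flippable n cs : bool :=
  find (fun F => diam_le n (n - 2) (map (flip F) (path_pairs 0 n.-1 ++ cs)))
    (flips n cs) < size (flips n cs).

(** In a strong digraph some chord must lead back over the step from v i to v i.+1 of the path. *)
Definition covered (cs : seq (nat * nat)) i :=
  has (fun c => c.1 <= i < c.2) cs.

Definition marked (cs : seq (nat * nat)) i :=
  has (fun c => [|| c.1 == i, c.2 == i | (c.1.+1 == i) && (c.2 == i.+1)]) cs.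

Definition admissible cs k :=
  all (fun i => covered cs i && ((i == 0) || marked cs i)) (iota 0 k).

Definition lex_lt (c d : nat * nat) :=
  (c.1 < d.1) || (c.1 == d.1) && (c.2 < d.2).

(** Each set of chords is generated once, in lexicographic order. The nested conditionals avoid
    evaluating pruned branches. *)
Fixpoint search n k cs : bool :=
  if k is k'.+1 then
    all (fun c => if all (fun d => lex_lt d c) cs then
                    if admissible cs c.1 then search n k' (rcons cs c) else true
                  else true) (chord_pairs n)
  else if admissible cs n.-1 then flippable n cs else true.

Lemma searchP : all (fun n => search n 4 [::]) (iota 0 13).
Proof. by vm_compute. Qed.

Lemma mem_chord_pairs n c : (c \in chord_pairs n) = (c.1.+1 < c.2 < n).
Proof.
case: c => i j /=; apply/allpairsPdep/idP => [[a [b [+ + [-> ->]]]]|ij].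
  by rewrite !mem_iota; lia.
by exists i, j; rewrite !mem_iota; split=> //; lia.
Qed.

Lemma mem_path_pairs i k c :
  (c \in path_pairs i k) = (i <= c.1 < i + k) && (c.2 == c.1.+1).
Proof.
case: c => a b /=; apply/mapP/idP => [[j + [-> ->]]|/andP[ak /eqP ->]].
  by rewrite mem_iota eqxx andbT.
by exists a => //; rewrite mem_iota.
Qed.

Lemma lex_lt_trans : transitive lex_lt.
Proof. by move=> [a b] [c d] [e f]; rewrite /lex_lt /=; lia. Qed.

Lemma sorted_chord_pairs n : n < 13 -> sorted lex_lt (chord_pairs n).
Proof.
have: all (fun n => sorted lex_lt (chord_pairs n)) (iota 0 13) by vm_compute.
by move/allP => H n13; apply: H; rewrite mem_iota.
Qed.

(* Chords that start at or after c.1 play no role for the vertices before c.1, so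
   the branches cut off by [search] contain no admissible list. *)
Lemma search_complete n k cs l :
    search n k cs -> size l = k -> pairwise lex_lt (cs ++ l) ->
    {subset l <= chord_pairs n} -> admissible (cs ++ l) n.-1 ->
  flippable n (cs ++ l).
Proof.
elim: k cs l => [|k IH] cs [|c l] //=; first by rewrite cats0 => + _ _ _ adm; rewrite adm.
move=> /allP sk [sl] pw lC adm.
have cC : c \in chord_pairs n by apply: lC; rewrite mem_head.
move: pw (pw); rewrite {1}pairwise_cat /= allrel_consr.
move=> /and3P[/andP[csc _] _ /andP[cl _]] pw.
rewrite -cat_rcons in adm pw *.
have {sk} := sk c cC; rewrite csc.
have -> : admissible cs c.1.
  apply/allP => j; rewrite mem_iota /= add0n; move: (j : nat) => {j} i ic.
  have := allP adm i; rewrite mem_iota /= add0n.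
  move: (cC); rewrite mem_chord_pairs => cn.
  have -> : i < n.-1.
    case/andP: cn => c12 c2n; apply: leq_trans ic _; rewrite -ltnS prednK //.
      exact: ltn_trans (ltnW c12) c2n.
    exact: leq_trans c2n.
  have late d : d \in c :: l -> i < d.1 < d.2.
    move=> dl; have := lC _ dl; rewrite mem_chord_pairs => /andP[/ltnW -> _].
    rewrite andbT; apply: leq_trans ic _.
    move: dl; rewrite inE => /orP[/eqP -> //|/(allP cl)].
    by case/orP => [/ltnW|/andP[/eqP ->]].
  rewrite cat_rcons /covered /marked !has_cat => /(_ isT) /andP[cov mk].
  apply/andP; split.
    case/orP: cov => // /hasP[d /late /andP[id _]].
    by rewrite leqNgt id.
  case/orP: mk => [->//|/orP[->|/hasP[d /late /andP[id dd]]]]; rewrite ?orbT //.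
  rewrite gtn_eqF // gtn_eqF ?(ltn_trans id) // gtn_eqF ?andbF //.
  exact: leq_trans id (leqnSn _).
move=> sk; apply: IH => // d dl; apply: lC; exact: mem_behead.
Qed.

End FiniteCheck.

(** * Digraphs of maximal diameter *)

Section HamiltonPath.
Local Open Scope nat_scope.

(* v enumerates the vertices along a directed path and rk is its inverse; by the last
   condition all the other arcs go backward. *)
Definition ham_path (T : finType) (D : rel T) (v : nat -> T) (rk : T -> nat) :=
  [/\ forall x, rk x < #|T| /\ v (rk x) = x,
      forall i, i < #|T| -> rk (v i) = i,
      forall i, i.+1 < #|T| -> D (v i) (v i.+1) &
      forall x y, D x y -> rk y <= (rk x).+1].

(** As [D] itself does not have the required diameter, two of its vertices are at distance above n -
    2, and a simple path joining them must visit all vertices. *)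
Lemma ham_path_exists (T : finType) (D : rel T) :
  oriented D -> strong D -> ~ reorientable D -> exists v rk, ham_path D v rk.
Proof.
move=> oD sD nD.
have [x [y nxy]] : exists x y, ~ reach D (#|T| - 2) x y.
  apply: contrapT => /forallNP H; apply: nD; exists D; split=> // x y.
  by apply: contrapT => nxy; apply: (H x); exists y.
have /connectP[p0 Dp0 ly0] := sD x y.
case/shortenP: Dp0 ly0 => p Dp Up _ ly {p0}.
have sp : #|T| - 2 < size p.
  by rewrite ltnNge; apply/negP => sp; apply: nxy; exists p.
have sT : size (x :: p) <= #|T| by rewrite -(card_uniqP Up) max_card.
have {sp}sT : size (x :: p) = #|T|.
  by apply/eqP; rewrite eqn_leq sT /=; move: sp => /=; lia.
have allp z : z \in x :: p.
  have c : #|x :: p| = #|T| by rewrite (card_uniqP Up).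
  by rewrite (elimT (subset_cardP c) (subset_predT _)).
pose v := nth x (x :: p); pose rk := index^~ (x :: p).
have vK i : i < #|T| -> rk (v i) = i by move=> iT; rewrite /rk /v index_uniq ?sT.
have rkK z : v (rk z) = z by rewrite /v /rk nth_index.
have step i : i.+1 < #|T| -> D (v i) (v i.+1).
  by move=> iT; apply: (pathP x Dp); rewrite -ltnS -/(size (x :: p)) sT.
have rT z : rk z < #|T| by rewrite -sT index_mem.
exists v, rk; split=> // a b Dab; rewrite leqNgt; apply/negP => ab.
(* A forward arc from a to b that skips a vertex would shorten the path to at most n - 2 arcs. *)
have fwd k i : i + k < #|T| -> reach D k (v i) (v (i + k)).
  elim: k => [|k IH] ik; first by rewrite addn0; exact: reach0.
  rewrite addnS in ik *; rewrite -addn1.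
  by apply: reachD (IH (ltnW ik)) _; exact/reach1/step.
have T0 : 0 < #|T| by apply: leq_ltn_trans (rT x).
apply: nxy; have -> : x = v 0 by [].
have -> : y = v #|T|.-1 by rewrite /v -sT /= ly (last_nth x).
have r1 := fwd (rk a) 0 (rT a); rewrite add0n rkK in r1.
have [] := (fwd (#|T|.-1 - rk b) (rk b)); first by have := rT b; lia.
rewrite rkK subnKC; last by have := rT b; lia.
move=> q r2; have r3 : reach D (#|T|.-1 - rk b) b (v #|T|.-1) by exists q.
apply: leq_reach (reachD r1 (reachD (reach1 Dab) r3)).
by have := rT b; lia.
Qed.

Variables (T : finType) (D : rel T) (v : nat -> T) (rk : T -> nat).
Hypotheses (oD : oriented D) (sD : strong D) (hp : ham_path D v rk).
Let n := #|T|.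

Lemma rk_lt x : rk x < n. Proof. by case: hp => H _ _ _; case: (H x). Qed.
Lemma rkK x : v (rk x) = x. Proof. by case: hp => H _ _ _; case: (H x). Qed.
Lemma vK i : i < n -> rk (v i) = i. Proof. by case: hp => _ H _ _; exact: H. Qed.
Lemma path_arc i : i.+1 < n -> D (v i) (v i.+1).
Proof. by case: hp => _ _ H _; exact: H. Qed.
Lemma rk_arc x y : D x y -> rk y <= (rk x).+1.
Proof. by case: hp => _ _ _; apply. Qed.

Lemma rk_inj : injective rk.
Proof. exact: can_inj rkK. Qed.

Definition chord i j := [&& i.+1 < j, j < n & D (v j) (v i)].
Lemma chordP i j : chord i j -> [/\ i.+1 < j, i < n, j < n & D (v j) (v i)].
Proof. by case/and3P => ij jn ->; split=> //; lia. Qed.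

Definition chords := [seq c <- chord_pairs n | chord c.1 c.2].

Lemma mem_chords i j : ((i, j) \in chords) = chord i j.
Proof.
rewrite mem_filter mem_chord_pairs /= /chord.
by case: (D _ _); case: (i.+1 < j); case: (j < n).
Qed.

Lemma arcE i j : i < n -> j < n -> D (v i) (v j) = (j == i.+1) || chord j i.
Proof.
move=> iN jN; apply/idP/orP => [Dij|[/eqP ej|/and3P[] //]]; last first.
  by rewrite ej; apply: path_arc; rewrite -ej.
have := rk_arc Dij; rewrite !vK //.
rewrite leq_eqVlt => /orP[->|]; first by left.
rewrite ltnS leq_eqVlt => /orP[/eqP ij|ji].
  by rewrite ij oriented_irr in Dij.
right; rewrite /chord iN Dij !andbT ltn_neqAle ji andbT.
apply: contraTneq Dij => ij; rewrite -ij.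
by apply: oD; apply: path_arc; rewrite ij.
Qed.

(** A walk from v i.+1 to v i must leave the vertices of rank above i, and only a chord does so. *)
Lemma chord_cover i : i.+1 < n -> exists a b, chord a b /\ a <= i < b.
Proof.
move=> iN.
have [||x [y [Ax Ay Dxy]]] :=
  @connect_exit _ D (fun x => i < rk x) (v i.+1) (v i) (sD _ _).
- by rewrite vK.
- by rewrite vK ?ltnn // ltnW.
exists (rk y), (rk x); rewrite -leqNgt in Ay; rewrite Ax Ay; split=> //.
have := arcE (rk_lt x) (rk_lt y); rewrite !rkK Dxy => /esym/orP[/eqP e|//].
by rewrite e in Ay; lia.
Qed.

Lemma card_arcs : #|arcs D| = n.-1 + size chords.
Proof.
have i_lt i : i \in iota 0 n.-1 -> i.+1 < n by rewrite mem_iota; lia.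
pose A := [seq (v i, v i.+1) | i <- iota 0 n.-1].
pose B := [seq (v c.2, v c.1) | c <- chords].
have e : arcs D =i A ++ B.
  move=> [x y]; rewrite inE mem_cat /= -{1}(rkK x) -{1}(rkK y) arcE ?rk_lt //.
  congr orb.
    apply/eqP/mapP => [e|[i /i_lt iN [-> ->]]]; last by rewrite !vK // ltnW.
    exists (rk x); last by rewrite -e !rkK.
    by rewrite mem_iota -e /=; have := rk_lt y; lia.
  rewrite -mem_chords; apply/idP/mapP => [c|[[i j] + [-> ->]]].
    by exists (rk y, rk x) => //=; rewrite !rkK.
  move=> c; have := c; rewrite (mem_chords i j) => /chordP[_ iN jN _].
  by rewrite !vK.
suff U : uniq (A ++ B).
  by rewrite (eq_card e) (card_uniqP U) size_cat !size_map size_iota.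
rewrite cat_uniq; apply/and3P; split.
- rewrite map_inj_in_uniq ?iota_uniq // => i j /i_lt iN /i_lt jN [/(congr1 rk)].
  by rewrite !vK // ltnW.
- apply/hasPn => _ /mapP[[i j] + ->] /=; rewrite mem_chords; move/chordP=> [ij iN jN _].
  apply/mapP => -[k /i_lt kN [/(congr1 rk) + /(congr1 rk)]].
  by rewrite !vK; lia.
- rewrite map_inj_in_uniq.
    rewrite filter_uniq // allpairs_uniq_dep ?iota_uniq // => [i _|].
      exact: iota_uniq.
    by move=> [i j] [i' j'] _ _ /= [-> ->].
  move=> [i j] [i' j']; rewrite !mem_chords => /chordP[_ iN jN _] /chordP[_ iN' jN' _] /=.
  by move=> -[/(congr1 rk) + /(congr1 rk)]; rewrite !vK; try lia; move=> -> ->.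
Qed.

(** To go back from v i.+1 to v i, walk forward to v j', jump to v i' and walk forward to v i. A
    general [R] serves both for [D] without a chord and for [D] induced on an interval. *)
Lemma interval_connect (R : rel T) a b :
    b < n -> (forall i, a <= i < b -> R (v i) (v i.+1)) ->
    (forall i, a <= i < b ->
       exists i' j', a <= i' <= i /\ i < j' <= b /\ R (v j') (v i')) ->
  forall i j, a <= i <= b -> a <= j <= b -> connect R (v i) (v j).
Proof.
move=> bn step cov.
have fwd i k : a <= i -> i + k <= b -> connect R (v i) (v (i + k)).
  move=> ai; elim: k => [|k IH] ik; first by rewrite addn0.
  rewrite addnS in ik *; apply: connect_trans (IH (ltnW ik)) _.
  by apply/connect1/step; lia.
have {}fwd i j : a <= i -> i <= j -> j <= b -> connect R (v i) (v j).
  by move=> ai ij jb; rewrite -(subnKC ij); apply: fwd; rewrite ?subnKC.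
have back i k : a <= i -> i + k <= b -> connect R (v (i + k)) (v i).
  move=> ai; elim: k => [|k IH] ik; first by rewrite addn0.
  rewrite addnS in ik *; apply: connect_trans (IH (ltnW ik)).
  have [|i' [j' [/andP[ai' i'k] [/andP[kj' j'b] Rji]]]] := cov (i + k); first by lia.
  apply: connect_trans (fwd _ _ _ kj' j'b) _; first by lia.
  by apply: connect_trans (connect1 Rji) (fwd _ _ ai' i'k (ltnW ik)).
move=> i j /andP[ai ib] /andP[aj jb].
case/orP: (leq_total i j) => ij; first exact: fwd.
by rewrite -(subnKC ij); apply: back; rewrite ?subnKC.
Qed.

Lemma redundant_strong a b : chord a b ->
    (forall i, a <= i < b -> exists i' j',
       [/\ chord i' j', i' <= i < j' & (i', j') != (a, b)]) ->
  strong [rel x y | D x y && ((x, y) != (v b, v a))].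
Proof.
move=> /chordP[ab an bn _] cov x y; set R := [rel _ _ | _].
have n0 : 0 < n by lia.
have le_n z : 0 <= rk z <= n.-1 by have := rk_lt z; lia.
rewrite -(rkK x) -(rkK y); apply: (@interval_connect R 0 n.-1) => //.
- by lia.
- move=> i iN; rewrite /R /= path_arc /=; last by lia.
  apply: contraTneq isT => -[/(congr1 rk) + /(congr1 rk)].
  by rewrite !vK; lia.
move=> i iN.
have [i' [j' [cij ij ne]]] : exists i' j',
    [/\ chord i' j', i' <= i < j' & (i', j') != (a, b)].
  have [/cov//|nab] := boolP (a <= i < b).
  have [|i' [j' [cij ij]]] := @chord_cover i; first by lia.
  by exists i', j'; split=> //; apply: contraNneq nab => -[<- <-].
have [_ iN' jN' Dji] := chordP cij; exists i', j'; split; first by lia.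
split; first by lia.
rewrite /R /= Dji /=; apply: contraNneq ne => -[/(congr1 rk) + /(congr1 rk)].
by rewrite !vK // => -> ->.
Qed.

Section Flip.
Variable F : seq (nat * nat).

Let E : rel T := [rel x y | undirected D x y &&
  (if rk x < rk y then (rk x, rk y) \notin F else (rk y, rk x) \in F)].

Lemma flip_oriented : oriented E /\ undirected E =2 undirected D.
Proof.
have rk_neq x y : undirected D x y -> rk x != rk y.
  apply: contraTneq => /rk_inj ->.
  by rewrite undirectedE orbb oriented_irr.
split=> x y.
  move=> /andP[uxy]; rewrite /E /= (undirected_sym D y) uxy /=.
  by case: ltngtP (rk_neq _ _ uxy) => // _ _; rewrite ?negbK.
rewrite undirectedE /E /= (undirected_sym D y) -andb_orr.
case uxy: (undirected D x y) => //=.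
by case: ltngtP (rk_neq _ _ uxy) => // _ _; case: (_ \in F).
Qed.

Let A := map (flip F) (path_pairs 0 n.-1 ++ chords).

Lemma flip_arc i j : (i, j) \in A -> [/\ E (v i) (v j), i < n & j < n].
Proof.
case/mapP => -[a b]; rewrite mem_cat mem_path_pairs mem_chords /= => ab e.
have [ab1 bn uab] : [/\ a < b, b < n & undirected D (v a) (v b)].
  case/orP: ab => [/andP[an /eqP ->]|/chordP[ab _ bn Dba]].
    rewrite undirectedE path_arc; last by lia.
    by split=> //; lia.
  by rewrite undirectedE Dba orbT; split=> //; lia.
have an := ltn_trans ab1 bn.
move: e; rewrite /flip /=; case: ifP => abF [-> ->]; split=> //; rewrite /E /= !vK //.
  by rewrite (undirected_sym D) uab ltnNge (ltnW ab1) abF.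
by rewrite uab ab1 abF.
Qed.

Lemma spread_reach S k u :
    (forall j, nth false S j -> j < n /\ reach E k u (v j)) ->
  forall j, nth false (spread A S) j -> j < n /\ reach E k.+1 u (v j).
Proof.
move=> HS; rewrite /spread.
have : {subset A <= A} by [].
have : forall j, nth false S j -> j < n /\ reach E k.+1 u (v j).
  by move=> j /HS [jn r]; split=> //; apply: leq_reach r.
(* Only the accumulator and the list of remaining arcs vary; the tested set [S] and the full list
   [A] stay fixed. *)
move: {1 3}S; elim: {1 3}A => //= -[a b] A' IH S' HS' sA.
apply: IH => [j|c cA]; last by apply: sA; rewrite inE cA orbT.
case: ifP => [/HS[an ra]|_]; last exact: HS'.
rewrite nth_set_nth /=; case: eqP => [-> _|_]; last exact: HS'.
have [Eab _ bn] := flip_arc (sA _ (mem_head _ _)).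
by split=> //; rewrite -addn1; apply: reachD ra (reach1 Eab).
Qed.

Lemma diam_le_reach k : diam_le n k A -> forall x y, reach E k x y.
Proof.
move=> dA x y; have := allP dA (rk x).
rewrite mem_iota rk_lt => /(_ isT) /allP /(_ (rk y)).
rewrite mem_iota rk_lt => /(_ isT).
suff H j : nth false (iter k (spread A) (set_nth false (nseq n false) (rk x) true)) j ->
    j < n /\ reach E k x (v j) by move/H => [_]; rewrite rkK.
elim: k j {dA} => [|k IH] j /=; last exact: spread_reach.
rewrite nth_set_nth /=; case: eqP => [->|_]; last by rewrite nth_nseq if_same.
by rewrite rkK rk_lt; split=> //; exact: reach0.
Qed.

End Flip.

Lemma flippable_reorientable : flippable n chords -> reorientable D.
Proof.
rewrite /flippable -has_find => /hasP[F _ /diam_le_reach rE].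
have [oE uE] := flip_oriented F.
by eexists; split; [exact: oE|exact: uE|].
Qed.

End HamiltonPath.

(** * The induction *)

Section Induction.
Local Open Scope nat_scope.

Definition dense_reorientable (T : finType) := forall D : rel T,
  oriented D -> strong D -> #|T| + 3 <= #|arcs D| -> reorientable D.

(** A single vertex carries no arc. The bound makes the truncated subtraction in [#|T| - 2]
    exact. *)
Lemma dense_card (T : finType) (D : rel T) :
  oriented D -> #|T| + 3 <= #|arcs D| -> 1 < #|T|.
Proof.
move=> oD mD; rewrite ltnNge; apply/negP => /fintype_le1P T1.
suff : #|arcs D| = 0 by lia.
apply: eq_card0 => -[x y]; rewrite !inE /=.
by rewrite (T1 x y) oriented_irr.
Qed.

Variables (T : finType) (D : rel T).
Hypotheses (oD : oriented D) (sD : strong D) (mD : #|T| + 3 <= #|arcs D|).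
Hypothesis IH : forall T' : finType, #|T'| < #|T| -> dense_reorientable T'.

(** The order drops by one and the number of arcs by at most one, so the quotient is dense enough
    for [IH]; lifting adds back one step. *)
Lemma suppress_reorientable w a b : D a w -> D w b ->
    (forall x, D x w -> x = a) -> (forall x, D w x -> x = b) ->
  ~~ undirected D a b -> reorientable D.
Proof.
move=> Daw Dwb in_w out_w nab.
have oS := suppress_oriented oD Daw Dwb nab.
have cT := card_suppress w; have cA := card_arcs_suppress oD Daw Dwb in_w out_w nab.
have mS : #|{: suppress_type w}| + 3 <= #|arcs (suppress D (w:=w) a b)|.
  by rewrite -ltnS; apply: leq_trans cA; rewrite -addSn cT.
have n1 := dense_card oS mS.
have sS := suppress_strong oD sD Daw in_w out_w.
have [|E [oE uE rE]] := @IH (suppress_type w) _ _ oS sS mS.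
  by rewrite -cT.
have [F [oF uF rF]] := suppress_lift oD Daw Dwb in_w out_w oE uE rE.
by exists F; split=> // x y; apply: leq_reach (rF x y); rewrite -cT subSn.
Qed.

(** The quotient has n - |K| + 1 vertices and loses only the arcs inside [K], so the last hypothesis
    makes it dense enough for [IH]. Lifting adds |K| - 1 steps, which gives n - 2 again. *)
Lemma contract_reorientable (K : {set T}) k0 : k0 \in K -> 1 < #|K| ->
    {in K &, forall x y, connect (induced D K) x y} ->
    (forall z y y', z \notin K -> y \in K -> y' \in K ->
      undirected D z y -> undirected D z y' -> y = y') ->
    #|T| + 4 + #|arcs (induced D K)| <= #|arcs D| + #|K| ->
  reorientable D.
Proof.
move=> k0K K1 sK nbr mK.
have oC := contract_oriented oD k0K nbr.
have sC := contract_strong (K:=K) (k0:=k0) sD.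
have cT := card_contract k0K; have cA := card_arcs_contract oD k0K nbr.
have mC : #|{: contract_type K k0}| + 3 <= #|arcs (contraction D (K:=K) (k0:=k0))| by lia.
have n1 : 1 < #|{: contract_type K k0}| := dense_card oC mC.
have lT : #|{: contract_type K k0}| < #|T| by lia.
have le : #|{: contract_type K k0}| - 2 + #|K|.-1 <= #|T| - 2 by lia.
have [E [oE uE rE]] := @IH (contract_type K k0) lT _ oC sC mC.
have [F [oF uF rF]] := contract_lift oD k0K sK oE uE rE.
by exists F; split=> // x y; apply: leq_reach (rF x y).
Qed.

Variables (v : nat -> T) (rk : T -> nat).
Hypothesis hp : ham_path D v rk.
Let n := #|T|.
Local Notation ch := (chord D v).
Local Notation chs := (chords D v).
Let rkK := rkK hp.
Let vK := vK hp.
Let rk_lt := rk_lt hp.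

Lemma neighbours x y : undirected D x y ->
  [\/ rk x = (rk y).+1, rk y = (rk x).+1, ch (rk x) (rk y) | ch (rk y) (rk x)].
Proof.
by case/orP; rewrite -{1}(rkK x) -{1}(rkK y) (arcE oD hp) ?rk_lt // => /orP[/eqP ->|];
  [constructor 2|constructor 4|constructor 1|constructor 3].
Qed.

(** Apart from [E], each vertex x of the interval has at most one arc inside it, to [f x]. So at
    most |K| + |E| arcs lie inside, and |K| cancels in the count of [contract_reorientable]. *)
Lemma contract_interval a b (f : T -> T) (E : {set T * T}) : a < b < n ->
    (forall i, a <= i < b -> exists i' j', [/\ ch i' j', a <= i' <= i & i < j' <= b]) ->
    (forall x y, a <= rk x <= b -> a <= rk y <= b -> D x y -> y = f x \/ (x, y) \in E) ->
    (forall z y y', ~~ (a <= rk z <= b) -> a <= rk y -> rk y < rk y' -> rk y' <= b ->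
      undirected D z y -> undirected D z y' -> False) ->
    n + 4 + #|E| <= #|arcs D| ->
  reorientable D.
Proof.
move=> /andP[ab bn] cov inner nbr mE.
have an := ltn_trans ab bn.
pose K := [set x | a <= rk x <= b]%SET.
have aK : v a \in K by rewrite inE vK // leqnn ltnW.
have bK : v b \in K by rewrite inE vK // leqnn ltnW.
apply: (@contract_reorientable K (v a)) => //.
- have <- : #|[set v a; v b]%SET| = 2.
    by rewrite cards2; case: eqP => // /(congr1 rk); rewrite !vK //; lia.
  apply/subset_leq_card/fintype.subsetP => x; rewrite !inE.
  by case/orP=> /eqP->; rewrite vK //; lia.
- move=> x y; rewrite !inE -(rkK x) -(rkK y) !vK //.
  have inK i : a <= i <= b -> v i \in K by move=> ib; rewrite inE vK //; lia.
  move=> xK yK; apply: (interval_connect bn) xK yK => i iab.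
    rewrite /induced /= (path_arc hp) ?inK //; lia.
  have [i' [j' [/chordP[_ _ _ Dji] ai' ij']]] := cov i iab; exists i', j'.
  split=> //; split=> //; rewrite /induced /= Dji ?inK //; lia.
- move=> z y y'; rewrite !inE => zK /andP[ay yb] /andP[ay' y'b] zy zy'.
  case: (ltngtP (rk y) (rk y')) => [yy|yy|/(rk_inj hp) //]; exfalso.
    exact: nbr zK ay yy y'b zy zy'.
  exact: nbr zK ay' yy yb zy' zy.
rewrite addnAC -/n; apply: (@leq_trans (n + 4 + #|E| + #|K|)); last by rewrite leq_add2r.
rewrite [n + _ + _]addnAC.
have : #|arcs (induced D K)| <= #|E| + #|K|; last by lia.
apply: (@leq_trans #|E :|: (fun x => (x, f x)) @: K|).
  apply/subset_leq_card/fintype.subsetP => -[x y]; rewrite !inE /=.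
  rewrite /induced /= !inE => /and3P[Dxy xK yK].
  have [yf|->] := inner x y xK yK Dxy; last by [].
  apply/orP; right; apply/imsetP; exists x; rewrite ?inE //.
  by rewrite -yf.
apply: (leq_trans (leq_card_setU _ _)).
by rewrite leq_add2l leq_imset_card.
Qed.

Lemma four_chords : #|arcs D| = n + 3 -> ~ reorientable D -> False.
Proof.
move=> mDn nD; have n1 := dense_card oD mD.
have s4 : size chs = 4.
  by have := card_arcs oD hp; rewrite mDn -/n; lia.
have chE i j : ((i, j) \in chs) = ch i j by exact: mem_chords.
have cov i : i < n.-1 -> exists a b, [/\ ch a b, a <= i & i < b].
  move=> iN.
  have [|a [b [cab /andP[ai ib]]]] := chord_cover oD sD hp (i := i); first by lia.
  by exists a, b.
(* An unmarked inner vertex meets no chord and its two path neighbours are not joined, so it could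
   be suppressed. *)
have mk i : 0 < i -> i < n.-1 -> marked chs i.
  move=> i0 iN; apply: contrapT => /negP nm; apply: nD.
  have nab a b : ch a b -> [/\ a != i, b != i & (a.+1 != i) || (b != i.+1)].
    rewrite -chE => cab; move/hasPn/(_ _ cab): nm => /=.
    by rewrite !negb_or negb_and => /and3P[].
  have iN' : i < n by lia.
  have i1 : i.-1.+1 = i by rewrite prednK.
  have iN1 : i.-1 < n by lia.
  have iN2 : i.+1 < n by lia.
  apply: (@suppress_reorientable (v i) (v i.-1) (v i.+1)).
  - by rewrite -{2}i1; apply: (path_arc hp); rewrite i1.
  - exact: (path_arc hp).
  - move=> x; rewrite -{1}(rkK x) (arcE oD hp) // ?rk_lt // => /orP[/eqP e|/nab[]].
      by rewrite e /= rkK.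
    by rewrite eqxx.
  - move=> x; rewrite -{1}(rkK x) (arcE oD hp) // ?rk_lt // => /orP[/eqP <-|/nab[_]].
      by rewrite rkK.
    by rewrite eqxx.
  - apply/negP => /neighbours; rewrite !vK // => -[||/nab[_ _]|/chordP[]]; try lia.
have adm : admissible chs n.-1.
  apply/allP => j; rewrite mem_iota add0n /=; move: (j : nat) => {j} i iN.
  apply/andP; split; last by case: posnP => //= i0; apply: mk.
  have [a [b [cab ai ib]]] := cov i iN.
  by apply/hasP; exists (a, b); rewrite ?chE //= ai.
(* Each of the four chords (a, b) accounts for at most three vertices: a, b and the possible middle
   a + 1. *)
have n13 : n < 13.
  pose L := flatten [seq [:: c.1; c.2; c.1.+1] | c <- chs].
  have sL : size L = 12.
    by rewrite /L; case: chs s4 => [|c1 [|c2 [|c3 [|c4 [|? ?]]]]].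
  rewrite ltnS -sL -(size_iota 0 n); apply: uniq_leq_size (iota_uniq _ _) _ => j.
  rewrite mem_iota add0n /=; move: (j : nat) => {j} i iN.
  have inL a b : ch a b -> i \in [:: a; b; a.+1] -> i \in L.
    move=> cab iab; apply/flattenP; exists [:: a; b; a.+1] => //.
    by apply/mapP; exists (a, b); rewrite ?chE.
  have [i0|i0] := posnP i.
    have [|a [b [cab ai ib]]] := cov i; first by lia.
    apply: inL cab _; rewrite inE; have <- : i = a by lia.
    by rewrite eqxx.
  have [iN1|iN1] := ltnP i n.-1.
    case/hasP: (mk i i0 iN1) => -[a b]; rewrite chE => cab /= m.
    apply: inL cab _; rewrite !inE !(eq_sym i).
    by case/or3P: m => [->|->|/andP[-> _]]; rewrite ?orbT.
  have [|a [b [cab ai ib]]] := cov i.-1; first by lia.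
  have [_ _ bn _] := chordP cab; apply: (inL _ _ cab).
  have <- : i = b by rewrite -/n in bn; lia.
  by rewrite !inE eqxx orbT.
have pw : pairwise lex_lt chs.
  rewrite -(sorted_pairwise lex_lt_trans) sorted_filter ?sorted_chord_pairs //.
  exact: lex_lt_trans.
have sn : search n 4 [::].
  by move/allP: searchP => H; have := H n; rewrite mem_iota n13 => ->.
have sub : {subset chs <= chord_pairs n} by move=> c; rewrite mem_filter => /andP[].
exact/nD/(flippable_reorientable oD hp)/(search_complete sn s4 pw sub adm).
Qed.

(** * Digraphs without redundant chords *)

Section Irredundant.
Hypothesis nD : ~ reorientable D.
(** By [redundant_strong], a chord without such a private step could be deleted. *)
Hypothesis private : forall a b, ch a b -> exists i, a <= i < b /\
  forall a' b', ch a' b' -> a' <= i < b' -> a' = a /\ b' = b.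

(** The private step of the inner chord is also covered by the outer one. *)
Lemma nested_chords a b a' b' :
  ch a b -> ch a' b' -> a' <= a -> b <= b' -> a' = a /\ b' = b.
Proof. by move=> /private[i [ib H]] c' aa bb; apply: H => //; lia. Qed.

(** Every chord lies in [L], since no other chord can cover its private step. *)
Lemma covering_chords (L : seq (nat * nat)) :
    (forall c, c \in L -> ch c.1 c.2) ->
    (forall i, i < n.-1 -> exists2 c, c \in L & c.1 <= i < c.2) ->
  size chs <= size L.
Proof.
move=> chL covL; apply: uniq_leq_size.
  rewrite filter_uniq // allpairs_uniq_dep ?iota_uniq // => [i _|].
    exact: iota_uniq.
  by move=> [i j] [i' j'] _ _ /= [-> ->].
move=> [a b]; rewrite mem_chords => cab.
have [_ _ bn _] := chordP cab; have [i [ib H]] := private cab.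
have [|[a' b'] cL /= ib'] := covL i; first by lia.
by have [<- <-] := H a' b' (chL _ cL) ib'.
Qed.

(** A chord covering step q then starts at q. *)
Definition uncrossed q := forall a b, ch a b -> ~~ (a < q < b).

(* Contract the cycle v q, ..., v h of a chord.  As no chord is redundant, this fails
   only if v h.+1 has a second neighbour v w on that cycle. *)
Lemma uncrossed_step q : uncrossed q -> q.+1 < n -> n + 4 <= #|arcs D| ->
  exists h w, [/\ ch q h, ch w h.+1, q < w < h & uncrossed h.+1].
Proof.
move=> uq qn mDn; have [a [h [cqh /andP[aq qh]]]] := chord_cover oD sD hp qn.
have {aq}aq : a = q by have := uq _ _ cqh; lia.
subst a; have [qh2 _ hn _] := chordP cqh.
apply: contrapT => no_step; apply: nD.
(* [f] is the successor on the cycle; any further chord inside would be nested in (q, h). *)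
apply: (@contract_interval q h
  (fun x => if rk x == h then v q else v (rk x).+1) finset.set0).
- by rewrite qh.
- by move=> i /andP[qi ih]; exists q, h; rewrite leqnn qi ih leqnn.
- move=> x y /andP[qx xh] /andP[qy yh].
  rewrite -{1}(rkK x) -{1}(rkK y) (arcE oD hp) ?rk_lt //.
  case/orP => [/eqP e|c]; left.
    by rewrite -e rkK; case: eqP => // xh'; move: yh; rewrite e xh' ltnn.
  by have [-> ->] := nested_chords c cqh qy xh; rewrite eqxx rkK.
(* A vertex z before q would need a chord across q to reach [y']. So z lies past h, and it must be v
   h.+1, joined to [y'] = v h by the path and to y by a chord. *)
- move=> z y y' zK qy yy y'h zy zy'.
  have [zq|zq] := ltnP (rk z) q.
    case: (neighbours zy') => [||c|/chordP[]]; try lia.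
    by have := uq _ _ c; lia.
  have zh : h < rk z by lia.
  have cyz : ch (rk y) (rk z).
    by case: (neighbours zy) => [||/chordP[]|]; try lia.
  have zy1 : rk z = (rk y').+1.
    case: (neighbours zy') => [||/chordP[]|c]; try lia.
    by have [] := nested_chords c cyz (ltnW yy) (leqnn _); lia.
  have zh1 : rk z = h.+1 by lia.
  rewrite zh1 in cyz.
  have qy1 : q < rk y.
    rewrite ltn_neqAle qy andbT; apply/eqP => e; rewrite -e in cyz.
    by have [] := nested_chords cqh cyz (leqnn _) (leqnSn _); lia.
  apply: no_step; exists h, (rk y); split=> //; first by lia.
  move=> a b cab; apply/negP => /andP[ah hb].
  (* The chord (q, h) covers the steps from y up to h - 1, so the private step is step h; a chord
     crossing h + 1 would cover it too. *)
  have [i [iyh H]] := private cyz.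
  have [ih|ih] := ltnP i h.
    by have [] := H _ _ cqh; lia.
  by have [] := H _ _ cab; lia.
- by rewrite cards0 addn0.
Qed.

(* By three uncrossed steps there are at least six chords, so the set v 0, ..., v h.+1
   of the first step can be contracted although it contains two of them. *)
Lemma irredundant_chords : n + 4 <= #|arcs D| -> False.
Proof.
move=> mDn; have n1 := dense_card oD mD.
have s5 : 4 < size chs by have := card_arcs oD hp; rewrite -/n; lia.
have u0 : uncrossed 0 by move=> a b _.
have [//|h [w [c0 c1 w0 u1]]] := uncrossed_step u0 _ mDn.
have [_ _ q1n _] := chordP c1.
(* If the path ends at v h.+1, the two chords found already cover it, so there are too few chords.
   The same test follows the second step. *)
have [q1e|q1N] := leqP n h.+2.
  suff : size chs <= 2 by lia.
  apply: (@covering_chords [:: (0, h); (w, h.+1)]) => [c|i iN].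
    by rewrite !inE => /orP[]/eqP->.
  have [ih|ih] := ltnP i h; first by exists (0, h); rewrite ?mem_head.
  by exists (w, h.+1); rewrite ?inE ?eqxx ?orbT //=; lia.
have [h2 [w2 [c2 c3 w2h u2]]] := uncrossed_step u1 q1N mDn.
have [_ _ q2n _] := chordP c3.
have [q2e|q2N] := leqP n h2.+2.
  suff : size chs <= 4 by lia.
  apply: (@covering_chords [:: (0, h); (w, h.+1); (h.+1, h2); (w2, h2.+1)]) => [c|i iN].
    by rewrite !inE => /or4P[]/eqP->.
  have [ih|ih] := ltnP i h; first by exists (0, h); rewrite ?mem_head.
  have [ih1|ih1] := ltnP i h.+1.
    by exists (w, h.+1); rewrite ?inE ?eqxx ?orbT //=; lia.
  have [ih2|ih2] := ltnP i h2.
    by exists (h.+1, h2); rewrite ?inE ?eqxx ?orbT //=; lia.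
  by exists (w2, h2.+1); rewrite ?inE ?eqxx ?orbT //=; lia.
have [h3 [w3 [c4 c5 w3h u3]]] := uncrossed_step u2 q2N mDn.
have s6 : 6 <= size chs.
  pose L := [:: (0, h); (w, h.+1); (h.+1, h2); (w2, h2.+1); (h2.+1, h3); (w3, h3.+1)].
  apply: (@uniq_leq_size _ L); first by rewrite /= !inE !xpair_eqE; lia.
  move=> c; rewrite !inE.
  by case/orP=> [/eqP->|/orP[/eqP->|/or4P[]/eqP->]]; rewrite mem_chords.
(* [f] follows the path and closes it by (w, h + 1); the chord (0, h) is the one exceptional arc. *)
apply: nD; apply: (@contract_interval 0 h.+1
  (fun x => if rk x == h.+1 then v w else v (rk x).+1) [set (v h, v 0)]%SET).
- by lia.
- move=> i ih; have [ih'|ih'] := ltnP i h; first by exists 0, h; split=> //; lia.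
  by exists w, h.+1; split=> //; lia.
- move=> x y xh yh; rewrite -{1}(rkK x) -{1}(rkK y) (arcE oD hp) ?rk_lt //.
  case/orP => [/eqP e|c].
    left; rewrite -e rkK; case: eqP => // xh'; lia.
  have [xe|xe] := eqVneq (rk x) h.+1.
    left; rewrite xe in c.
    have -> : w = rk y.
      case/orP: (leq_total w (rk y)) => wy.
        by have [] := nested_chords c c1 wy (leqnn _).
      by have [] := nested_chords c1 c wy (leqnn _).
    by rewrite rkK.
  right; have [] := nested_chords c c0 (leq0n _); first by lia.
  by move=> e1 e2; rewrite inE xpair_eqE e1 e2 !rkK !eqxx.
- move=> z y y' zK y0 yy y'h zy _.
  case: (neighbours zy) => [||/chordP[]|c]; try lia.
  by have := u1 _ _ c; lia.
(* The exceptional arc raises the requirement to n + 5 arcs: n - 1 on the path and six chords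
   suffice. *)
- by rewrite cards1; have := card_arcs oD hp; rewrite -/n; lia.
Qed.

End Irredundant.
End Induction.

(** The outer induction, on the order, serves suppression and contraction; the inner one, on the
    number of arcs, serves the deletion of redundant chords. *)
Lemma strong_reorientable (T : finType) : dense_reorientable T.
Proof.
have [N] := ubnP #|T|; elim: N T => // N IHT T; rewrite ltnS => TN D.
have [M] := ubnP #|arcs D|; elim: M D => // M IHD D; rewrite ltnS => DM oD sD mD.
have IH (T' : finType) : (#|T'| < #|T|)%N -> dense_reorientable T'.
  by move=> T'T; apply: IHT; apply: leq_trans T'T TN.
apply: contrapT => nD; have [v [rk hp]] := ham_path_exists oD sD nD.
have [mDn|mDn] := leqP #|arcs D| (#|T| + 3)%N.
  by apply: (four_chords oD sD mD IH hp) nD; apply/eqP; rewrite eqn_leq mDn.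
apply: (irredundant_chords oD sD mD IH hp nD); last by rewrite addnS.
(* Without a private step the chord is redundant, and it can be deleted because there are more than
   n + 3 arcs. *)
move=> a b cab; apply: contrapT => np.
have sD' := redundant_strong oD sD hp cab.
have [_ _ _ Dba] := chordP cab.
apply: nD; pose D' : rel T := [rel x y | D x y && ((x, y) != (v b, v a))].
have oD' : oriented D' by move=> x y /andP[/oD/negbTE Dyx _]; rewrite /D' /= Dyx.
have mD' : #|arcs D| = #|arcs D'|.+1.
  rewrite (cardsD1 (v b, v a)) inE Dba add1n; congr _.+1.
  by apply: eq_card => -[x y]; rewrite !inE andbC.
apply: (@reorientableS _ _ D') => //; first by move=> x y /andP[].
apply: IHD => //; [by rewrite mD' in DM| |by rewrite mD' ltnS addnS -addnS in mDn; lia].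
apply: sD' => i iab; apply: contrapT => ncov; apply: np; exists i.
split=> // a' b' c' ib'.
apply: contrapT => ne; apply: ncov; exists a', b'; split=> //.
by apply/eqP => -[e1 e2]; apply: ne.
Qed.

(** * Back to simple graphs and [min_size] *)

Lemma diameter_le (T : finType) (E : rel T) (k : nat) :
  (forall x y, reach E k x y) -> diameter E <= k%:Z%:E.
Proof.
move=> rE; rewrite /diameter; elim/big_ind: _ => [|u v uk vk|[x y] _ /=].
- by rewrite leNye.
- by rewrite ge_max uk vk.
(* [dipath] asks for distinct vertices, so the walk is shortened first. *)
have [p [Ep lp sp Up]] := reach_uniq (rE x y).
have xy : dipath E x y (size p).
  by apply/existsP; exists (in_tuple p); rewrite Ep lp eqxx andbT.
rewrite /distance; case: pselect => [ex|[]]; last by exists (size p).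
case: ex_minnP => m _ /(_ _ xy) mp; rewrite lee_fin lez_nat.
exact: leq_trans sp.
Qed.

Lemma size_forcesP (n : nat) : size_forces n (n - 2)%N (n + 3)%N%:Z.
Proof.
move=> G bG oG; rewrite lez_nat => mG.
have [D [oD uD sD]] := robbins bG.
have mD : (#|G| + 3 <= #|arcs D|)%N.
  rewrite oG; apply: leq_trans mG _; pose ends (p : G * G) := [set p.1; p.2]%SET.
  apply: (@leq_trans #|ends @: arcs D|); last exact: leq_imset_card.
  apply/subset_leq_card/fintype.subsetP => _ /imsetP[[x y] + ->].
  rewrite inE /= -uD undirectedE => /orP[Dxy|Dyx].
    by apply/imsetP; exists (x, y); rewrite ?inE.
  by apply/imsetP; exists (y, x); rewrite ?inE // finset.setUC.
have [E [oE uE rE]] := strong_reorientable oD sD mD.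
exists E; split; last by rewrite -oG; exact: diameter_le.
have adjE x y : adj x y = E x y || E y x by rewrite -uD -uE undirectedE.
split=> x y; rewrite adjE; first by move->.
by case Exy: (E x y); case Eyx: (E y x) => //=; have := oE _ _ Exy; rewrite Eyx.
Qed.

Theorem theorem2 (n : nat) (hn : (5 <= n)%N) :
  min_size n (n - 2)%N <= (n + 3)%N%:Z%:E.
Proof.
(* [is_min_size] rules out [+oo], and [-oo] lies below every bound; an integer value remains. *)
have := min_sizeP n (n - 2)%N; case: (min_size _ _) => //= s [_ min_s].
by rewrite lee_fin; apply/min_s/size_forcesP.
Qed.
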